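(* Let $H$ be a non-zero complex separable Hilbert space and let $T=(T_1,\ldots,T_d)$ be a commuting operator-valued multishift on $\ell^2_H(\mathbb N^d)$ with invertible operator weights $\{A^{(j)}_\alpha:\alpha\in\mathbb N^d,\ j=1,\ldots,d\}$. Let $\mathscr B=\{B_\alpha:\alpha\in\mathbb N^d\}$ be the associated multisequence of moments. Then the set of all bounded point evaluations on $\mathcal H^2(\mathscr B)$ is contained in $\sigma_p(T^* )$ and is given by $$\Omega:=\Big\{w\in\mathbb C^d:\ \sup_{x\in H,\ \|x\|=1}\ \sum_{\alpha\in\mathbb N^d}|w^\alpha|^2\,\|B_\alpha^{*-1}x\|^2<\infty\Big\}.$$
   Context: $\mathbb N$ is the set of non-negative integers, $d\ge1$, and $\varepsilon_j\in\mathbb N^d$ has $1$ in the $j$th place and $0$ elsewhere. $\ell^2_H(\mathbb N^d)=\oplus_{\alpha\in\mathbb N^d}H$. Given invertible bounded operators $A^{(j)}_\alpha$ on $H$, the operator-valued multishift $T=(T_1,\dots,T_d)$ on $\ell^2_H(\mathbb N^d)$ with these weights is $T_j(\oplus_\alpha x_\alpha)=\oplus_\alpha A^{(j)}_{\alpha-\varepsilon_j}x_{\alpha-\varepsilon_j}$, where the $\alpha$-entry is $0$ if $\alpha_j=0$. It is commuting if $\sup_\alpha\|A^{(j)}_\alpha\|<\infty$ for every $j$ (equivalently each $T_j$ is bounded) and $A^{(i)}_{\alpha+\varepsilon_j}A^{(j)}_\alpha=A^{(j)}_{\alpha+\varepsilon_i}A^{(i)}_\alpha$ for all $\alpha,i,j$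 (equivalently the $T_j$ commute). Moments: $A^{(j)}(\alpha,k)=A^{(j)}_{\alpha-\varepsilon_j}A^{(j)}_{\alpha-2\varepsilon_j}\cdots A^{(j)}_{\alpha-k\varepsilon_j}$ for $1\le k\le\alpha_j$, $A^{(j)}(\alpha,0)=I$, and $$B_\alpha=A^{(1)}(\alpha,\alpha_1)\,A^{(2)}(\alpha-\alpha_1\varepsilon_1,\alpha_2)\cdots A^{(d)}\Big(\alpha-\sum_{l=1}^{d-1}\alpha_l\varepsilon_l,\ \alpha_d\Big),$$ an invertible bounded operator on $H$. $B_\alpha^{*-1}=(B_\alpha^* )^{-1}$. $\mathcal H^2(\mathscr B)$ is the Hilbert space of formal power series $\sum_{\alpha\in\mathbb N^d}x_\alpha z^\alpha$, $x_\alpha\in H$, with $\sum_\alpha\|B_\alpha x_\alpha\|^2<\infty$, with inner product $\langle\sum x_\alpha z^\alpha,\sum y_\alpha z^\alpha\rangle=\sum_\alpha\langle B_\alpha x_\alpha,B_\alpha y_\alpha\rangle_H$. A point $w\in\mathbb C^d$ is a bounded point evaluation on $\mathcal H^2(\mathscr B)$ if the map $E_w:p\mapsto p(w)$ from the $H$-valued polynomials in $\mathcal H^2(\mathscr B)$ to $H$ extends to a continuous linear map $\mathcal H^2(\mathscr B)\to H$. $w^\alpha=\prod_jw_j^{\alpha_j}$; $\sigma_p(T^* )$ is the joint point spectrum of $T^*=(T_1^*,\dots,T_d^* )$, i.e. the set of $w\in\mathbb C^d$ with $\bigcap_{j}\ker(T_j^*-w_jI)\ne\{0\}$. *)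

(* Defs.v *)
From HB Require Import structures.
From mathcomp Require Import all_boot all_order all_algebra.
From mathcomp Require Import complex ring lra finmap.
From mathcomp Require Import all_classical all_reals all_analysis.
Set Implicit Arguments.
Unset Strict Implicit.
Unset Printing Implicit Defensive.
Import Order.TTheory GRing.Theory Num.Theory.
Import numFieldNormedType.Exports.
Local Open Scope classical_set_scope.
Local Open Scope ring_scope.

(* [inner] is linear in its first and conjugate-linear in its second argument;
   as always in a normed module over R[i], `|x| is an element of R[i]. *)
HB.mixin Record NormedModule_hasInner (R : realType) V & NormedModule R[i] V := {
  inner : {dot V for Num.conj};
  inner_norm : forall x : V, inner x x = `|x| ^+ 2 }.

#[short(type="preHilbertType")]
HB.structure Definition PreHilbert (R : realType) :=
  { V of NormedModule R[i] V & NormedModule_hasInner R V }.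

#[short(type="hilbertType")]
HB.structure Definition Hilbert (R : realType) :=
  { V of PreHilbert R V & Complete V }.

(* The norm as an element of R. *)
Definition rnorm (R : realType) (V : normedModType R[i]) (x : V) : R :=
  complex.Re `|x|.

Section ComplexNorm.
Variables (R : realType).
Implicit Types (a : R[i]) (r : R).

Lemma normc_re a : `|a| = (complex.Re `|a|)%:C%C.
Proof. by case: a => a b. Qed.

Lemma re_normc_sqr a : (complex.Re `|a|) ^+ 2 = (complex.Re a) ^+ 2 + (complex.Im a) ^+ 2.
Proof. by case: a => a b /=; rewrite sqr_sqrtr// addr_ge0// sqr_ge0. Qed.

Lemma re_normc_ge0 a : 0 <= complex.Re `|a|.
Proof. by case: a => a b /=; rewrite sqrtr_ge0. Qed.

Lemma cReD a b : complex.Re (a + b) = complex.Re a + complex.Re b.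
Proof. by case: a; case: b. Qed.

Lemma cImD a b : complex.Im (a + b) = complex.Im a + complex.Im b.
Proof. by case: a; case: b. Qed.

Lemma cReM a b : complex.Re (a * b) =
  complex.Re a * complex.Re b - complex.Im a * complex.Im b.
Proof. by case: a; case: b. Qed.

Lemma cImM a b : complex.Im (a * b) =
  complex.Re a * complex.Im b + complex.Im a * complex.Re b.
Proof. by case: a; case: b. Qed.

Lemma cconjE a : (a^*)%R = conjc a.
Proof. by []. Qed.

Lemma cReC a : complex.Re (a^*)%R = complex.Re a.
Proof. by case: a. Qed.

Lemma cImC a : complex.Im (a^*)%R = - complex.Im a.
Proof. by case: a. Qed.

Lemma complex_eq a b :
  complex.Re a = complex.Re b -> complex.Im a = complex.Im b -> a = b.
Proof. by case: a; case: b => ? ? ? ? /= -> ->. Qed.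

End ComplexNorm.

Section DotNorm.
Variables (R : realType) (V : lmodType R[i]) (f : {dot V for Num.conj}).
Implicit Types (x y : V).

Definition dot_sqn x : R := complex.Re (f x x).

Local Notation q := dot_sqn.

Lemma dot_sqnE x : f x x = (q x)%:C%C.
Proof.
have := dnorm_ge0 f x; rewrite /q; case: (f x x) => a b.
by rewrite lecE /= => /andP[/eqP ->].
Qed.

Lemma dot_sqn_ge0 x : 0 <= q x.
Proof. by have := dnorm_ge0 f x; rewrite dot_sqnE ler0c. Qed.

Lemma dotC x y : f y x = (f x y)^*%R.
Proof. by rewrite hermitian_subproof expr0 mul1r. Qed.

Lemma dot_sqnD x y : q (x + y) = q x + 2 * complex.Re (f x y) + q y.
Proof.
have h : complex.Re (f y x) = complex.Re (f x y) by rewrite dotC cReC.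
by rewrite /q linearDl !linearDr/= !cReD h mulr2n mulrDl mul1r !addrA.
Qed.

Lemma dot_sqnZ (a : R[i]) x : q (a *: x) = (complex.Re `|a|) ^+ 2 * q x.
Proof.
rewrite /q linearZl_LR linearZr_LR/= mulrA -normCK normc_re dot_sqnE.
by rewrite -rmorphXn -rmorphM.
Qed.

Lemma dot_CS x y : complex.Re (f x y) <= Num.sqrt (q x) * Num.sqrt (q y).
Proof.
have [y0|y0] := eqVneq (q y) 0.
  have : f y y = 0 by rewrite dot_sqnE y0.
  move/eqP; rewrite dnorm_eq0 => /eqP ->.
  by rewrite linear0r /= mulr_ge0 ?sqrtr_ge0.
have yp : 0 < q y by rewrite lt_neqAle eq_sym y0 dot_sqn_ge0.
pose t : R := - (complex.Re (f x y) / q y).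
have := dot_sqn_ge0 (x + t%:C%C *: y).
rewrite dot_sqnD dot_sqnZ linearZr_LR/= cReM /= oppr0 mul0r subr0.
rewrite expr0n /= addr0 sqr_sqrtr ?sqr_ge0//.
rewrite /t; set r := complex.Re _ => h.
have h2 : r ^+ 2 <= q x * q y.
  rewrite -subr_ge0.
  have -> : q x * q y - r ^+ 2 =
      (q x + 2 * (- (r / q y) * r) + (- (r / q y)) ^+ 2 * q y) * q y by field.
  by rewrite mulr_ge0 // ltW.
rewrite -sqrtrM ?dot_sqn_ge0//.
apply: (le_trans (ler_norm _)).
by rewrite -sqrtr_sqr ler_wsqrtr.
Qed.

Definition dot_norm x : R[i] := (Num.sqrt (q x))%:C%C.

Lemma dot_normD x y : dot_norm (x + y) <= dot_norm x + dot_norm y.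
Proof.
rewrite /dot_norm -rmorphD /= lecR.
rewrite -(@ler_pXn2r _ 2) ?nnegrE ?addr_ge0 ?sqrtr_ge0//.
rewrite sqrrD !sqr_sqrtr ?dot_sqn_ge0// dot_sqnD.
by rewrite lerD2r lerD2l -[leRHS]mulr_natl ler_pM2l// dot_CS.
Qed.

Lemma dot_normZ (a : R[i]) x : dot_norm (a *: x) = `|a| * dot_norm x.
Proof.
rewrite /dot_norm dot_sqnZ sqrtrM ?sqr_ge0// sqrtr_sqr.
by rewrite ger0_norm ?re_normc_ge0// rmorphM /= -normc_re.
Qed.

Lemma dot_norm0_eq0 x : dot_norm x = 0 -> x = 0.
Proof.
move=> /complexI /eqP; rewrite sqrtr_eq0 => q0.
have {}q0 : q x = 0 by apply/eqP; rewrite eq_le q0 dot_sqn_ge0.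
by apply/eqP; rewrite -(dnorm_eq0 f) dot_sqnE q0.
Qed.

End DotNorm.

(* A positive definite form on a complex vector space makes it a pre-Hilbert
   space. *)
HB.factory Record Lmodule_hasInner (R : realType) V & GRing.Lmodule R[i] V := {
  dotform : {dot V for Num.conj} }.

HB.builders Context R V & Lmodule_hasInner R V.

HB.instance Definition _ := Lmodule_isNormed.Build R[i] V
  (@dot_normD R V dotform) (@dot_normZ R V dotform)
  (@dot_norm0_eq0 R V dotform).

Let inner_nm (x : V) : dotform x x = `|x| ^+ 2.
Proof.
rewrite dot_sqnE -[ `|x| ]/(dot_norm dotform x) /dot_norm -rmorphXn /=.
by rewrite sqr_sqrtr// dot_sqn_ge0.
Qed.

HB.instance Definition _ := NormedModule_hasInner.Build R V inner_nm.

HB.end.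

Section AbsoluteSums.
Variables (R : realType) (I : choiceType).
Implicit Types (f g u v : I -> R).

Definition rsum f : R :=
  fine (\esum_(i in [set: I]) (EFin \o f)^\+%E i) -
  fine (\esum_(i in [set: I]) (EFin \o f)^\-%E i).

(* Meaningful when the real and imaginary parts are summable. *)
Definition csum (c : I -> R[i]) : R[i] :=
  Complex (rsum (fun i => complex.Re (c i))) (rsum (fun i => complex.Im (c i))).

Lemma esumZ (k : R) f : 0 <= k -> (forall i, 0 <= f i) ->
  (\esum_(i in [set: I]) (k * f i)%:E =
   k%:E * \esum_(i in [set: I]) (f i)%:E)%E.
Proof.
move=> k0 f0; rewrite /esum -ereal_supZl//; last first.
  apply/set0P; exists (\sum_(i \in set0) (f i)%:E)%E.
  by exists set0 => //; split.
congr ereal_sup; rewrite image_comp; apply: eq_imagel => A _ /=.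
rewrite ge0_mule_fsumr; last by move=> i; rewrite lee_fin.
by apply: eq_fsbigr => i _; rewrite EFinM.
Qed.

Lemma esum_pos_fin f : (forall i, 0 <= f i) -> summable [set: I] (EFin \o f) ->
  (\esum_(i in [set: I]) (f i)%:E)%E \is a fin_num.
Proof.
move=> f0; rewrite summableE; congr (_ \is a fin_num).
by apply: eq_esum => i _ /=; rewrite ger0_norm.
Qed.

Lemma rsum_sub u v : (forall i, 0 <= u i) -> (forall i, 0 <= v i) ->
  summable [set: I] (EFin \o u) -> summable [set: I] (EFin \o v) ->
  rsum (fun i => u i - v i) = fine (\esum_(i in [set: I]) (u i)%:E) -
                              fine (\esum_(i in [set: I]) (v i)%:E).
Proof.
move=> u0 v0 su sv.
have h : EFin \o (fun i => u i - v i) = ((EFin \o u) \- (EFin \o v))%E.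
  by apply/funext => i /=; rewrite EFinB.
have suv : summable [set: I] (EFin \o (fun i => u i - v i)).
  by rewrite h; exact: summableB.
have sp := summable_funepos suv; have sn := summable_funeneg suv.
rewrite /rsum -!fineB ?esum_pos_fin//.
- rewrite h esumB//= => i _; rewrite lee_fin//.
- move: sp; rewrite summableE; congr (_ \is a fin_num).
  by apply: eq_esum => i _ /=; rewrite gee0_abs.
- move: sn; rewrite summableE; congr (_ \is a fin_num).
  by apply: eq_esum => i _ /=; rewrite gee0_abs.
Qed.

Lemma rsum_ge0E f : (forall i, 0 <= f i) ->
  rsum f = fine (\esum_(i in [set: I]) (f i)%:E).
Proof.
move=> f0; rewrite /rsum [X in _ - fine X]esum1 ?subr0; last first.
  by move=> i _; rewrite funenegE/= max_r// lee_fin oppr_le0.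
congr fine; apply: eq_esum => i _.
by rewrite funeposE/= max_l// lee_fin.
Qed.

Let pos f i := Num.max (f i) 0.
Let neg f i := Num.max (- f i) 0.

Let pos0 f i : 0 <= pos f i. Proof. by rewrite /pos le_max lexx orbT. Qed.
Let neg0 f i : 0 <= neg f i. Proof. by rewrite /neg le_max lexx orbT. Qed.

Let posneg f i : f i = pos f i - neg f i.
Proof. by rewrite /pos /neg /Num.max; case: ifP; case: ifP; lra. Qed.

Lemma le_summable f g : (forall i, `|f i| <= `|g i|) ->
  summable [set: I] (EFin \o g) -> summable [set: I] (EFin \o f).
Proof.
move=> fg; apply: le_lt_trans; apply: le_esum => i _ /=.
by rewrite lee_fin.
Qed.

Let pos_summable f :
  summable [set: I] (EFin \o f) -> summable [set: I] (EFin \o pos f).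
Proof.
apply: le_summable => i; rewrite ger0_norm ?pos0//.
by rewrite /pos ge_max normr_ge0 ler_norm.
Qed.

Let neg_summable f :
  summable [set: I] (EFin \o f) -> summable [set: I] (EFin \o neg f).
Proof.
apply: le_summable => i; rewrite ger0_norm ?neg0//.
by rewrite /neg ge_max normr_ge0 -normrN ler_norm.
Qed.

Lemma rsummableD f g : summable [set: I] (EFin \o f) ->
  summable [set: I] (EFin \o g) ->
  summable [set: I] (EFin \o (fun i => f i + g i)).
Proof. by move=> sf sg; exact: (summableD sf sg). Qed.

Lemma rsummableZ k f : summable [set: I] (EFin \o f) ->
  summable [set: I] (EFin \o (fun i => k * f i)).
Proof.
move=> sf; rewrite /summable /=.
under eq_esum do rewrite normrM.
by rewrite esumZ// lte_mul_pinfty.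
Qed.

Lemma rsumD f g : summable [set: I] (EFin \o f) ->
  summable [set: I] (EFin \o g) ->
  rsum (fun i => f i + g i) = rsum f + rsum g.
Proof.
move=> sf sg.
have -> : (fun i => f i + g i) =
    (fun i => (pos f i + pos g i) - (neg f i + neg g i)).
  by apply/funext => i; rewrite {1}(posneg f) {1}(posneg g); ring.
rewrite (_ : rsum f = rsum (fun i => pos f i - neg f i)); last first.
  by congr rsum; apply/funext => i; rewrite -posneg.
rewrite (_ : rsum g = rsum (fun i => pos g i - neg g i)); last first.
  by congr rsum; apply/funext => i; rewrite -posneg.
have [pf pg] := (pos_summable sf, pos_summable sg).
have [nf ng] := (neg_summable sf, neg_summable sg).
rewrite !rsum_sub//; try by [move=> i; rewrite addr_ge0|exact: rsummableD].
under eq_esum do rewrite EFinD.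
rewrite esumD//; try by move=> i _; rewrite lee_fin.
under [X in _ - fine X]eq_esum do rewrite EFinD.
rewrite esumD//; try by move=> i _; rewrite lee_fin.
rewrite !fineD ?esum_pos_fin//; ring.
Qed.

Lemma rsumN f : summable [set: I] (EFin \o f) ->
  rsum (fun i => - f i) = - rsum f.
Proof.
move=> sf.
rewrite (_ : (fun i => - f i) = (fun i => neg f i - pos f i)); last first.
  by apply/funext => i; rewrite {1}(posneg f) opprB.
rewrite (_ : rsum f = rsum (fun i => pos f i - neg f i)); last first.
  by congr rsum; apply/funext => i; rewrite -posneg.
have [pf nf] := (pos_summable sf, neg_summable sf).
by rewrite !rsum_sub// opprB.
Qed.

Lemma rsumZ k f : summable [set: I] (EFin \o f) ->
  rsum (fun i => k * f i) = k * rsum f.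
Proof.
wlog k0 : k / 0 <= k => [wl|] sf.
  have [/wl->//|k0] := leP 0 k.
  rewrite (_ : (fun i => _) = (fun i => - (- k * f i))); last first.
    by apply/funext => i; rewrite mulNr opprK.
  rewrite rsumN; last exact: rsummableZ.
  by rewrite wl// ?mulNr ?opprK// oppr_ge0 ltW.
rewrite (_ : (fun i => _) = (fun i => k * pos f i - k * neg f i)); last first.
  by apply/funext => i; rewrite {1}(posneg f) mulrBr.
rewrite (_ : rsum f = rsum (fun i => pos f i - neg f i)); last first.
  by congr rsum; apply/funext => i; rewrite -posneg.
have [pf nf] := (pos_summable sf, neg_summable sf).
rewrite !rsum_sub//; try by [move=> i; rewrite mulr_ge0|exact: rsummableZ].
by rewrite !esumZ// !fineM ?esum_pos_fin// mulrBr.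
Qed.

Definition csummable (c : I -> R[i]) :=
  summable [set: I] (EFin \o (fun i => complex.Re (c i))) /\
  summable [set: I] (EFin \o (fun i => complex.Im (c i))).

Lemma csumD (c e : I -> R[i]) : csummable c -> csummable e ->
  csum (fun i => c i + e i) = csum c + csum e.
Proof.
move=> [cr ci] [er ei]; apply: complex_eq; rewrite ?cReD ?cImD /csum /=.
  by rewrite -rsumD//; congr rsum; apply/funext => i; rewrite cReD.
by rewrite -rsumD//; congr rsum; apply/funext => i; rewrite cImD.
Qed.

Lemma csumZ (a : R[i]) (c : I -> R[i]) : csummable c ->
  csum (fun i => a * c i) = a * csum c.
Proof.
move=> [cr ci]; apply: complex_eq.
  rewrite [RHS]cReM /csum /= -!rsumZ// -rsumN; last exact: rsummableZ.
  rewrite -rsumD; [|exact: rsummableZ|]; last first.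
    have := rsummableZ (complex.Im a) ci; rewrite summableN.
    by congr summable; apply/funext => i /=; rewrite EFinN.
  by congr rsum; apply/funext => i; rewrite cReM.
rewrite [RHS]cImM /csum /= -!rsumZ// -rsumD; try exact: rsummableZ.
by congr rsum; apply/funext => i; rewrite cImM.
Qed.

Lemma csum_conj (c : I -> R[i]) : csummable c ->
  csum (fun i => (c i)^*%R) = (csum c)^*%R.
Proof.
move=> [cr ci]; apply: complex_eq; rewrite ?cReC ?cImC /csum /=.
  by congr rsum; apply/funext => i; rewrite cReC.
by rewrite -rsumN//; congr rsum; apply/funext => i; rewrite cImC.
Qed.

End AbsoluteSums.

(* The default value of [get] is irrelevant when V is a Hilbert space and f is
   linear and continuous: the adjoint then exists and is unique. *)
Definition adjoint (R : realType) (V : preHilbertType R) (f : V -> V) : V -> V :=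
  get [set g : V -> V | forall x y, inner (f x) y = inner x (g y)].

Definition opnorm (R : realType) (V : normedModType R[i]) (f : V -> V) : \bar R :=
  ereal_sup [set (rnorm (f x))%:E | x in [set x : V | rnorm x <= 1]].

Definition separable_space (T : topologicalType) : Prop :=
  exists2 D : set T, countable D & dense D.

Definition joint_point_spectrum (R : realType) (V : normedModType R[i])
    (d : nat) (S : 'I_d -> V -> V) : set ('I_d -> R[i]) :=
  [set w | exists2 x : V, x != 0 &
    (\bigcap_(j in [set: 'I_d]) [set y | S j y - w j *: y = 0]) x].

(* Bounded operators with a bounded inverse. *)
Record invop (R : realType) (H : normedModType R[i]) := Invop {
  iop :> {linear H -> H};
  iopV : {linear H -> H};
  iop_continuous : continuous iop;
  iopV_continuous : continuous iopV;
  iopK : cancel iop iopV;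
  iopVK : cancel iopV iop }.

Section InvertibleOperators.
Variables (R : realType) (H : normedModType R[i]).

Definition invop_id : invop H :=
  @Invop R H idfun idfun (fun x => cvg_id) (fun x => cvg_id)
    (fun=> erefl) (fun=> erefl).

Definition invop_comp (A B : invop H) : invop H.
Proof.
apply: (@Invop R H (A \o B) (iopV B \o iopV A)).
- by move=> x; apply: continuous_comp; exact: iop_continuous.
- by move=> x; apply: continuous_comp; exact: iopV_continuous.
- by move=> x /=; rewrite !iopK.
- by move=> x /=; rewrite !iopVK.
Defined.

End InvertibleOperators.

Definition mindex (d : nat) := {ffun 'I_d -> nat}.
HB.instance Definition _ d := Countable.on (mindex d).
HB.instance Definition _ d := GRing.Nmodule.on (mindex d).

Definition mi_eps d (j : 'I_d) : mindex d := [ffun i => (i == j : nat)].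

(* Truncated subtraction, only used where b <= a. *)
Definition mi_sub d (a b : mindex d) : mindex d := [ffun i => (a i - b i)%N].

Definition mpow (R : realType) d (w : 'I_d -> R[i]) (a : mindex d) : R[i] :=
  \prod_(j < d) w j ^+ a j.

Section Weights.
Variables (R : realType) (H : normedModType R[i]) (d : nat).
Variable A : 'I_d -> mindex d -> invop H.
Implicit Types (a : mindex d) (j : 'I_d).

Definition bounded_weights : Prop :=
  forall j, (ereal_sup [set opnorm (A j a) | a in [set: mindex d]] < +oo)%E.

Definition commuting_weights : Prop :=
  forall a i j (x : H),
    A i (a + mi_eps j) (A j a x) = A j (a + mi_eps i) (A i a x).

(* A^(j)(a,k) = A^(j)_(a - eps_j) o ... o A^(j)_(a - k eps_j) *)
Definition weight_prod j a (k : nat) : invop H :=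
  \big[@invop_comp R H/@invop_id R H]_(1 <= i < k.+1)
    A j (mi_sub a (mi_eps j *+ i)).

(* B_a = A^(1)(a, a_1) o A^(2)(a - a_1 eps_1, a_2) o ... ; the big operator
   composes its factors in increasing order of j. *)
Definition moment a : invop H :=
  \big[@invop_comp R H/@invop_id R H]_(j < d)
    weight_prod j (mi_sub a (\sum_(l < d | (l < j)%N) mi_eps l *+ a l)) (a j).

End Weights.

Section RealNorm.
Variable R : realType.

Lemma rnormE (V : normedModType R[i]) (x : V) : `|x| = (rnorm x)%:C%C.
Proof.
have := normr_ge0 x; rewrite /rnorm; case: `|x| => u v.
by rewrite lecE /= => /andP[/eqP ->].
Qed.

Lemma rnorm_ge0 (V : normedModType R[i]) (x : V) : 0 <= rnorm x.
Proof. by have := normr_ge0 x; rewrite rnormE ler0c. Qed.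

Lemma rnormZ (V : normedModType R[i]) (k : R[i]) (x : V) :
  rnorm (k *: x) = complex.Re `|k| * rnorm x.
Proof.
apply: (@complexI R); rewrite -rnormE normrZ rnormE normc_re.
by rewrite -rmorphM.
Qed.

Lemma rnorm_distD (V : normedModType R[i]) (x y z : V) :
  rnorm (y - z) <= rnorm (x - y) + rnorm (x - z).
Proof.
have := ler_distD x y z; rewrite (distrC y x).
by rewrite (rnormE (y - z)) (rnormE (x - y)) (rnormE (x - z)) -rmorphD lecR.
Qed.

Lemma rnorm_sqE (V : preHilbertType R) (x : V) :
  rnorm x ^+ 2 = dot_sqn inner x.
Proof.
by have := inner_norm x; rewrite dot_sqnE rnormE -rmorphXn => /complexI ->.
Qed.

Lemma dot_sqnB (V : lmodType R[i]) (f : {dot V for Num.conj}) (x y : V) :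
  dot_sqn f (x - y) = dot_sqn f x - 2 * complex.Re (f x y) + dot_sqn f y.
Proof.
rewrite dot_sqnD -scaleN1r dot_sqnZ normrN1 /= expr1n mul1r.
by rewrite linearZr_LR /= rmorphN rmorph1 mulN1r raddfN mulrN.
Qed.

Lemma rnorm_sqD (V : preHilbertType R) (x y : V) :
  rnorm (x + y) ^+ 2 <= 2 * rnorm x ^+ 2 + 2 * rnorm y ^+ 2.
Proof.
rewrite !rnorm_sqE.
have := dot_sqn_ge0 inner (x - y); rewrite dot_sqnB dot_sqnD.
lra.
Qed.

Lemma inner_Re (V : preHilbertType R) (x y : V) :
  `|complex.Re (inner x y)| <= rnorm x ^+ 2 + rnorm y ^+ 2.
Proof.
rewrite !rnorm_sqE ler_norml.
have := dot_sqn_ge0 inner (x - y); have := dot_sqn_ge0 inner (x + y).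
have := dot_sqn_ge0 inner x; have := dot_sqn_ge0 inner y.
rewrite dot_sqnB dot_sqnD.
lra.
Qed.

Lemma inner_Im (V : preHilbertType R) (x y : V) :
  `|complex.Im (inner x y)| <= rnorm x ^+ 2 + rnorm y ^+ 2.
Proof.
have := inner_Re x ('i%C *: y); rewrite linearZr_LR /= cReM /=.
rewrite rnormZ /= expr0n expr1n add0r sqrtr1 mul1r.
by rewrite mul0r sub0r mulN1r opprK.
Qed.

End RealNorm.

Section WeightedPred.
Variables (R : realType) (H : hilbertType R) (d : nat).
Variable B : mindex d -> invop H.

(* [hsq B] is the space H^2(B) of formal power series, encoded by their
   coefficients; B = id gives the Hilbert direct sum l^2_H(N^d). *)
Definition hsq_pred : {pred (mindex d -> H)} :=
  mem [set x : mindex d -> H |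
    (\esum_(a in [set: mindex d]) (rnorm (B a (x a)) ^+ 2)%:E < +oo)%E].

Record hsq := Hsq { hsq_coef :> mindex d -> H; hsq_coefP : hsq_coef \in hsq_pred }.

HB.instance Definition _ := [isSub for hsq_coef].
HB.instance Definition _ := [Choice of hsq by <:].

Lemma hsq_submod_closed : submod_closed hsq_pred.
Proof.
split.
  rewrite inE /= esum1// => a _.
  by rewrite linear0 /rnorm normr0 expr0n.
move=> k x y; rewrite !inE /= => xP yP.
pose u a : R := rnorm (B a (x a)) ^+ 2; pose v a : R := rnorm (B a (y a)) ^+ 2.
pose c : R := 2 * complex.Re `|k| ^+ 2.
have c0 : 0 <= c by rewrite mulr_ge0 ?sqr_ge0.
have u0 a : 0 <= u a by exact: sqr_ge0.
have v0 a : 0 <= v a by exact: sqr_ge0.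
apply: (@le_lt_trans _ _ (\esum_(a in [set: mindex d]) (c * u a)%:E +
                          \esum_(a in [set: mindex d]) (2 * v a)%:E)%E).
  rewrite -esumD; [|by move=> a _; rewrite lee_fin mulr_ge0..].
  apply: le_esum => a _; rewrite -EFinD lee_fin linearD linearZ /=.
  by apply: (le_trans (rnorm_sqD _ _)); rewrite rnormZ exprMn mulrA.
by rewrite !esumZ// lte_add_pinfty// lte_mul_pinfty.
Qed.

HB.instance Definition _ := GRing.isSubmodClosed.Build _ _ hsq_pred
  hsq_submod_closed.
HB.instance Definition _ := [SubChoice_isSubLmodule of hsq by <:].

Lemma hsq_sqsum (x : hsq) :
  (\esum_(a in [set: mindex d]) (rnorm (B a (x a)) ^+ 2)%:E < +oo)%E.
Proof. by have := hsq_coefP x; rewrite inE. Qed.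

Lemma hsq_coefD (x y : hsq) a : (x + y) a = x a + y a.
Proof. by []. Qed.

Lemma hsq_coefZ (k : R[i]) (x : hsq) a : (k *: x) a = k *: x a.
Proof. by []. Qed.

Definition hsq_inner (x y : hsq) : R[i] :=
  csum (fun a : mindex d => inner (B a (x a)) (B a (y a))).

Lemma hsq_csummable (x y : hsq) :
  csummable (fun a : mindex d => inner (B a (x a)) (B a (y a))).
Proof.
have h : (\esum_(a in [set: mindex d])
    (rnorm (B a (x a)) ^+ 2 + rnorm (B a (y a)) ^+ 2)%:E < +oo)%E.
  under eq_esum do rewrite EFinD.
  rewrite esumD; [|by move=> a _; rewrite lee_fin sqr_ge0..].
  by rewrite lte_add_pinfty ?hsq_sqsum.
split; apply: le_lt_trans h; apply: le_esum => a _ /=; rewrite lee_fin.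
  exact: inner_Re.
exact: inner_Im.
Qed.

Lemma hsq_inner_linear (y : hsq) : linear_for *%R (hsq_inner ^~ y).
Proof.
move=> k x x'; rewrite /hsq_inner -csumZ; last exact: hsq_csummable.
rewrite -csumD; last 2 first.
- have := hsq_csummable (k *: x) y; congr csummable; apply/funext => a.
  by rewrite hsq_coefZ linearZ linearZl_LR.
- exact: hsq_csummable.
congr csum; apply/funext => a.
by rewrite hsq_coefD hsq_coefZ linearP linearDl linearZl_LR.
Qed.

Lemma hsq_innerC (x y : hsq) : hsq_inner x y = (hsq_inner y x)^*%R.
Proof.
rewrite /hsq_inner -csum_conj; last exact: hsq_csummable.
by congr csum; apply/funext => a; rewrite dotC.
Qed.

Lemma hsq_inner_antilinear (x : hsq) :
  linear_for (Num.conj \; *%R) (hsq_inner x).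
Proof.
move=> k y y'; rewrite hsq_innerC hsq_inner_linear rmorphD rmorphM /=.
by rewrite -!hsq_innerC.
Qed.

Lemma hsq_inner_sqsum (x : hsq) : hsq_inner x x =
  (fine (\esum_(a in [set: mindex d]) (rnorm (B a (x a)) ^+ 2)%:E))%:C%C.
Proof.
have e a : inner (B a (x a)) (B a (x a)) = (rnorm (B a (x a)) ^+ 2)%:C%C.
  by rewrite rnorm_sqE -dot_sqnE.
rewrite /hsq_inner; under [X in csum X]funext do rewrite e.
apply: complex_eq => /=; first by rewrite rsum_ge0E// => a; exact: sqr_ge0.
by rewrite rsum_ge0E// esum1.
Qed.

Lemma hsq_inner_gt0 (x : hsq) : x != 0 -> 0 < hsq_inner x x.
Proof.
move=> x0; rewrite hsq_inner_sqsum ltcR fine_gt0// hsq_sqsum andbT.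
have [a xa0] : exists a, x a != 0.
  apply: contrapT => h; move/eqP: x0; apply; apply: val_inj.
  apply/funext => a; apply/eqP/negP => /negP ha.
  by apply: h; exists a.
apply: (@lt_le_trans _ _ (rnorm (B a (x a)) ^+ 2)%:E).
  rewrite lte_fin exprn_gt0// lt_neqAle rnorm_ge0 andbT eq_sym.
  apply: contraNneq xa0 => n0.
  have : `|B a (x a)| = 0 by rewrite rnormE n0.
  by move/normr0_eq0/(congr1 (iopV (B a))); rewrite iopK linear0 => ->.
apply: esum_ge; exists [set a].
  by split=> //; exact: finite_set1.
by rewrite fsbig_set1.
Qed.

HB.instance Definition _ := bilinear_isBilinear.Build R[i] hsq hsq R[i]
  *%R (Num.conj \; *%R) hsq_inner
  (hsq_inner_linear, hsq_inner_antilinear).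

Lemma hsq_inner_herm (x y : hsq) :
  hsq_inner x y = (-1) ^+ false * (hsq_inner y x)^*%R.
Proof. by rewrite expr0 mul1r hsq_innerC. Qed.

HB.instance Definition _ := isHermitianSesquilinear.Build R[i] hsq false
  Num.conj hsq_inner hsq_inner_herm.

HB.instance Definition _ := isDotProduct.Build R[i] hsq hsq_inner hsq_inner_gt0.

HB.instance Definition _ := Lmodule_hasInner.Build R hsq
  (hsq_inner : {dot hsq for Num.conj}).

End WeightedPred.

Section WeightedComplete.
Variables (R : realType) (H : hilbertType R) (d : nat).
Variable B : mindex d -> invop H.

Lemma rnorm_ball (V : normedModType R[i]) (x y : V) (r : R) :
  ball x r%:C%C y <-> rnorm (x - y) < r.
Proof. by rewrite -ball_normE /= rnormE ltcR. Qed.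

Lemma hsq_rnorm (x : hsq B) : ((rnorm x ^+ 2)%:E =
  \esum_(a in [set: mindex d]) (rnorm (B a (x a)) ^+ 2)%:E)%E.
Proof.
have h : hsq_inner x x = (rnorm x ^+ 2)%:C%C.
  by rewrite -[hsq_inner x x]/(inner x x) rnorm_sqE -dot_sqnE.
rewrite hsq_inner_sqsum in h; rewrite -(complexI h) fineK//.
rewrite ge0_fin_numE ?hsq_sqsum// esum_ge0// => a _.
by rewrite lee_fin sqr_ge0.
Qed.

Lemma hsq_finsum_le (x : hsq B) (A : set (mindex d)) : finite_set A ->
  \sum_(a <- fset_set A) rnorm (B a (x a)) ^+ 2 <= rnorm x ^+ 2.
Proof.
move=> fA; rewrite -lee_fin hsq_rnorm -sumEFin -fsbig_finite//.
by apply: ereal_sup_ubound; exists A.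
Qed.

Lemma hsq_coef_le (x : hsq B) a : rnorm (B a (x a)) <= rnorm x.
Proof.
rewrite -(@ler_pXn2r _ 2) ?nnegrE ?rnorm_ge0//.
have := hsq_finsum_le x (finite_set1 a).
by rewrite fset_set1 big_seq_fset1.
Qed.

Let quarter (p q s r : R) :
  p <= q + s -> q <= r / 2 -> s < r / 4 -> 0 < r -> p < r.
Proof. lra. Qed.

Lemma hsq_complete (F : set_system (hsq B)) :
  ProperFilter F -> cauchy F -> cvg F.
Proof.
move=> FF /cauchyP Fc.
have CE (r : R) : 0 < r -> exists x, F [set y | rnorm (x - y) < r].
  move=> r0; have [|x Fx] := Fc r%:C%C; first by rewrite ltcR.
  by exists x; apply: filterS Fx => y /rnorm_ball.
have cv a : cvg ((fun x : hsq B => B a (x a)) @ F).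
  apply: cauchy_cvg; apply/cauchy_exP => e e0.
  have [r er] : exists r : R, e = r%:C%C.
    exists (complex.Re e); move: e0; case: e => u v.
    by rewrite ltcE /= => /andP[/eqP ->].
  have [|x Fx] := CE r; first by move: e0; rewrite er ltcR.
  exists (B a (x a)).
  change (F [set y | ball (B a (x a)) e (B a (y a))]); apply: filterS Fx => y /= xy; rewrite er.
  apply/rnorm_ball; apply: le_lt_trans xy; rewrite /= -linearB.
  exact: (hsq_coef_le (x - y) a).
pose c a : H := lim ((fun x : hsq B => B a (x a)) @ F).
have Fcoef a (s : R) : 0 < s -> F [set y | rnorm (c a - B a (y a)) < s].
  move=> s0; have /cvg_ballP/(_ s%:C%C) := cv a.
  rewrite ltcR => /(_ s0); apply: filterS => y /=.
  by move/rnorm_ball.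
have key (r : R) (x : hsq B) : 0 < r -> F [set y | rnorm (x - y) < r] ->
    (\esum_(a in [set: mindex d]) (rnorm (B a (x a) - c a) ^+ 2)%:E <=
     (4 * r ^+ 2)%:E)%E.
  move=> r0 Fx; apply: ge_ereal_sup => _ [A [fA _] <-].
  rewrite fsbig_finite// sumEFin lee_fin.
  set n := size (fset_set A); pose s := r / n.+1%:R.
  have s0 : 0 < s by rewrite divr_gt0.
  have FA : F (\bigcap_(a in [set` fset_set A])
      [set y | rnorm (c a - B a (y a)) < s]).
    by apply: filter_bigI => a _; exact: Fcoef.
  have [y [/= xy yA]] := filter_ex (filterI Fx FA).
  have le1 a : a \in fset_set A -> rnorm (B a (x a) - c a) ^+ 2 <=
      2 * rnorm (B a ((x - y) a)) ^+ 2 + 2 * s ^+ 2.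
    move=> aA.
    have -> : B a (x a) - c a = B a ((x - y) a) - (c a - B a (y a)).
      by rewrite [(x - y) a]/(x a - y a) linearB opprB addrA subrK.
    apply: le_trans (rnorm_sqD _ _) _; rewrite lerD2l ler_pM2l//.
    rewrite -[X in rnorm X]scaleN1r rnormZ normrN1 mul1r.
    by rewrite ler_pXn2r ?nnegrE ?rnorm_ge0// ltW//; exact: yA.
  apply: (@le_trans _ _ (\sum_(a <- fset_set A)
      (2 * rnorm (B a ((x - y) a)) ^+ 2 + 2 * s ^+ 2))).
    by rewrite big_seq [leRHS]big_seq; apply: ler_sum => a; exact: le1.
  rewrite big_split /= -mulr_sumr big_const_seq count_predT iter_addr_0 -/n.
  have h1 := hsq_finsum_le (x - y) fA.
  have h2 : rnorm (x - y) ^+ 2 <= r ^+ 2.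
    by rewrite ler_pXn2r ?nnegrE ?rnorm_ge0 ?ltW.
  have h3 : s ^+ 2 *+ n <= r ^+ 2.
    rewrite /s expr_div_n -mulr_natr -mulrA ler_piMr ?sqr_ge0//.
    rewrite mulrC ler_pdivrMr ?exprn_gt0// mul1r -natrX ler_nat.
    by rewrite (leq_trans (leqnSn n))// leq_pmulr.
  lra.
have [x1 Fx1] := CE 1 ltr01.
have esE (x : hsq B) a : rnorm (B a (x a - iopV (B a) (c a))) =
    rnorm (B a (x a) - c a) by rewrite linearB/= iopVK.
pose y0 a := iopV (B a) (c a).
have zP (x : hsq B) r : 0 < r -> F [set y | rnorm (x - y) < r] ->
    (fun a => x a - y0 a) \in hsq_pred B.
  move=> r0 Fx; rewrite inE /=.
  under eq_esum do rewrite esE.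
  exact: le_lt_trans (key _ _ r0 Fx) (ltry _).
have y0P : y0 \in hsq_pred B.
  have -> : y0 = hsq_coef x1 - (fun a => x1 a - y0 a).
    by apply/funext => a; rewrite /= fctE /= opprB addrC subrK.
  by rewrite rpredB ?hsq_coefP// (zP _ 1).
pose Y : hsq B := Hsq y0P.
apply/cvg_ex; exists Y; apply/cvg_ballP => e e0.
have [r er] : exists r : R, e = r%:C%C.
  exists (complex.Re e); move: e0; case: e => u v.
  by rewrite ltcE /= => /andP[/eqP ->].
have r0 : 0 < r by move: e0; rewrite er ltcR.
have r40 : 0 < r / 4 by rewrite divr_gt0.
have [x Fx] := CE _ r40; apply: filterS (Fx) => y /= xy; rewrite er.
apply/rnorm_ball.
have xY : rnorm (x - Y) <= r / 2.
  suff h : ((rnorm (x - Y) ^+ 2)%:E <= ((r / 2) ^+ 2)%:E)%E.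
    by move: h; rewrite lee_fin ler_pXn2r ?nnegrE ?rnorm_ge0 ?divr_ge0 ?(ltW r0).
  rewrite hsq_rnorm.
  rewrite (_ : esum _ _ = \esum_(a in [set: mindex d])
      (rnorm (B a (x a) - c a) ^+ 2)%:E); last first.
    by apply: eq_esum => a _; rewrite -esE.
  by apply: le_trans (key _ _ r40 Fx) _; rewrite lee_fin; lra.
have tri : rnorm (Y - y) <= rnorm (x - Y) + rnorm (x - y).
  exact: rnorm_distD.
exact: quarter tri xY xy r0.
Qed.

HB.instance Definition _ := Uniform_isComplete.Build (hsq B) hsq_complete.

End WeightedComplete.

Notation l2 H d := (hsq (fun _ : mindex d => @invop_id _ H)).

Section Shift.
Variables (R : realType) (H : hilbertType R) (d : nat).
Variable A : 'I_d -> mindex d -> invop H.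

Definition multishift_fun (j : 'I_d) (x : mindex d -> H) : mindex d -> H := fun a =>
  if a j == 0%N then 0 else A j (mi_sub a (mi_eps j)) (x (mi_sub a (mi_eps j))).

Lemma rnorm_opnorm (j : 'I_d) : bounded_weights A -> exists2 M : R, 0 <= M &
  forall a x, rnorm (A j a x) <= M * rnorm x.
Proof.
move=> /(_ j) bA.
have h a x : rnorm x <= 1 -> ((rnorm (A j a x))%:E <=
    ereal_sup [set opnorm (A j a) | a in [set: mindex d]])%E.
  move=> x1; apply: (@le_trans _ _ (opnorm (A j a))).
    by apply: ereal_sup_ubound; exists x.
  by apply: ereal_sup_ubound; exists a.
have [M sM] : exists M : R,
    ereal_sup [set opnorm (A j a) | a in [set: mindex d]] = M%:E.
  exists (fine (ereal_sup [set opnorm (A j a) | a in [set: mindex d]])).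
  rewrite fineK// fin_numElt bA andbT.
  apply: (@lt_le_trans _ _ (rnorm (A j 0 0))%:E); first exact: ltNyr.
  by apply: h; rewrite /rnorm normr0.
rewrite sM in h; exists M.
  rewrite -lee_fin; apply: le_trans (h 0 0 _); first by rewrite lee_fin rnorm_ge0.
  by rewrite /rnorm normr0.
move=> a x; have [->|x0] := eqVneq x 0.
  by rewrite linear0 /rnorm normr0 mulr0.
have nx : 0 < rnorm x.
  rewrite lt_neqAle rnorm_ge0 andbT eq_sym; apply: contraNneq x0 => n0.
  by rewrite -normr_eq0 rnormE n0.
have := h a ((rnorm x)^-1%:C%C *: x); rewrite lee_fin linearZ /= !rnormZ /=.
rewrite expr0n addr0 sqrtr_sqr ger0_norm ?invr_ge0 ?(ltW nx)//.
rewrite mulVf ?gt_eqF// lexx => /(_ isT).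
by rewrite mulrC ler_pdivrMr.
Qed.

Lemma mi_subK (j : 'I_d) (a : mindex d) : mi_sub (a + mi_eps j) (mi_eps j) = a.
Proof. by apply/ffunP => i; rewrite !ffunE addnK. Qed.

Lemma mi_addK (j : 'I_d) (a : mindex d) : a j != 0%N ->
  mi_sub a (mi_eps j) + mi_eps j = a.
Proof.
move=> aj; apply/ffunP => i; rewrite !ffunE.
have [->|_] := eqVneq i j; last by rewrite subn0 addr0.
by apply: subnK; rewrite lt0n.
Qed.

Lemma multishift_in (Abd : bounded_weights A) (j : 'I_d) (x : l2 H d) :
  multishift_fun j x \in hsq_pred (fun _ : mindex d => @invop_id _ H).
Proof.
have [M M0 AM] := rnorm_opnorm j Abd.
rewrite inE /=; pose v a : R := rnorm (x a) ^+ 2.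
have v0 a : 0 <= v a by exact: sqr_ge0.
rewrite (@esum_mkcond _ _ [set: mindex d]) /=.
apply: (@le_lt_trans _ _
  (\esum_(a in [set: mindex d]) (M ^+ 2 * v a)%:E)%E); last first.
  by rewrite esumZ ?sqr_ge0// lte_mul_pinfty ?lee_fin ?sqr_ge0//;
    exact: (hsq_sqsum x).
pose Q := [set a : mindex d | a j != 0%N].
rewrite (_ : esum _ _ = \esum_(a in Q) (rnorm (multishift_fun j x a) ^+ 2)%:E);
  last first.
  rewrite [RHS]esum_mkcond; apply: eq_esum => a _; rewrite in_setT.
  case: ifPn => //; rewrite notin_setE /Q /= => /negP; rewrite negbK => a0.
  by rewrite /multishift_fun a0 /rnorm normr0 expr0n.
rewrite (@reindex_esum _ _ _ [set: mindex d] _ (fun a => a + mi_eps j)).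
  apply: le_esum => a _; rewrite lee_fin /multishift_fun mi_subK.
  case: ifP => [_|_]; first by rewrite /rnorm normr0 expr0n mulr_ge0 ?sqr_ge0.
  by rewrite -exprMn ler_pXn2r ?nnegrE ?rnorm_ge0// mulr_ge0 ?rnorm_ge0.
split.
- by move=> a _; rewrite /Q /= !ffunE eqxx -[_ + _]/(a j + 1)%N addn1.
- move=> a b _ _ /(congr1 (fun c => mi_sub c (mi_eps j))).
  by rewrite !mi_subK.
- by move=> a aj; exists (mi_sub a (mi_eps j)); rewrite ?mi_addK.
Qed.

Definition multishift (Abd : bounded_weights A) (j : 'I_d) (x : l2 H d) : l2 H d :=
  Hsq (multishift_in Abd j x).

End Shift.

Section PointEvaluations.
Variables (R : realType) (H : hilbertType R) (d : nat).
Variable B : mindex d -> invop H.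

Definition is_polynomial (x : hsq B) : Prop :=
  finite_set [set a : mindex d | x a != 0].

(* The sum is finite when x is a polynomial; only this case is used. *)
Definition peval (w : 'I_d -> R[i]) (x : hsq B) : H :=
  \sum_(a \in [set: mindex d]) mpow w a *: x a.

Definition bounded_point_evaluations : set ('I_d -> R[i]) :=
  [set w | exists E : {linear hsq B -> H}, continuous E /\
     forall x : hsq B, is_polynomial x -> E x = peval w x].

(* The adjoint of an invertible operator is a bijection, and 'pinv_ is then its
   inverse. *)
Definition inv_adjoint (T : invop H) : H -> H :=
  'pinv_(fun=> 0) [set: H] (adjoint T).

Definition Omega : set ('I_d -> R[i]) :=
  [set w | (ereal_sup [set
       \esum_(a in [set: mindex d])
         (complex.Re `|mpow w a| ^+ 2 * rnorm (inv_adjoint (B a) x) ^+ 2)%:E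
     | x in [set x : H | rnorm x = 1%R]] < +oo)%E].

End PointEvaluations.

(* Main.v *)
Require Import Defs.
From HB Require Import structures.
From mathcomp Require Import all_boot all_order all_algebra.
From mathcomp Require Import complex ring lra finmap.
From mathcomp Require Import all_classical all_reals all_analysis.
Import Order.TTheory GRing.Theory Num.Theory.
Import numFieldNormedType.Exports.
Local Open Scope classical_set_scope.
Local Open Scope ring_scope.
Set Implicit Arguments.
Unset Strict Implicit.
Unset Printing Implicit Defensive.

(** Write [N a] for the inverse of the adjoint of [B a].

    A bounded evaluation [E] at [w] has an adjoint [g]. Comparing inner products
    with the monomials, one finds that [g y] is the power series whose image
    under [B a] has the coefficients [(w^a)^* N a y], so its squared norm is the
    sum over [a] of [|w^a|^2 |N a y|^2]. Boundedness of [g] is thus the condition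
    that defines [Omega] ([point_evaluation_Omega]). Conversely, for [w] in
    [Omega] these power series define a bounded map from [H] to the space of
    power series, and its adjoint is a bounded linear map that agrees with
    evaluation at [w] on the monomials, hence on the polynomials
    ([Omega_point_evaluation]).

    For [w] in [Omega] and [y] non-zero, the same summability says that
    [x a = w^a N a y] is an element of l^2. Since the weights commute,
    [B (a + eps_j) = A j a o B a] ([momentS]), so the adjoint of [A j a] maps
    [N (a + eps_j) y] to [N a y]; the adjoint of [T j] therefore multiplies [x]
    by [w j] ([Omega_point_spectrum]). Note that the eigenvector has the
    coefficients [w^a], whereas [g y] has their conjugates: the inclusion in the
    point spectrum goes through [Omega], which depends on [|w^a|] only.

    Adjoints of bounded operators come from Riesz's representation theorem
    ([riesz_representation]), proved by minimising
    [rnorm x ^+ 2 - 2 * Re (phi x)]. *)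

(** * Inner products and norms *)

Lemma sqrt_dot_sqn (R : realType) (V : preHilbertType R) (x : V) :
  Num.sqrt (dot_sqn inner x) = rnorm x.
Proof. by rewrite -rnorm_sqE sqrtr_sqr ger0_norm ?rnorm_ge0. Qed.

Lemma Re_inner_le (R : realType) (V : preHilbertType R) (x y : V) :
  complex.Re (inner x y) <= rnorm x * rnorm y.
Proof. by rewrite -!sqrt_dot_sqn dot_CS. Qed.

Lemma Re_innerC (R : realType) (V : preHilbertType R) (x y : V) :
  complex.Re (inner x y) = complex.Re (inner y x).
Proof. by rewrite dotC cReC. Qed.

Lemma rnormN (R : realType) (V : normedModType R[i]) (x : V) :
  rnorm (- x) = rnorm x.
Proof. by rewrite /rnorm normrN. Qed.

Lemma rnorm_eq0 (R : realType) (V : normedModType R[i]) (x : V) :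
  rnorm x = 0 -> x = 0.
Proof. by move=> x0; apply/normr0_eq0; rewrite rnormE x0. Qed.

(** Adjoints, coefficients and linearity are all identified by testing against
    the inner product. *)
Lemma inner_eqP (R : realType) (V : preHilbertType R) (x y : V) :
  (forall h, inner h x = inner h y) -> x = y.
Proof.
move=> xy; apply/eqP; rewrite -subr_eq0; apply/eqP/rnorm_eq0/eqP.
by rewrite -sqrf_eq0 rnorm_sqE /dot_sqn linearBr/= xy subrr.
Qed.

Lemma rnormZr (R : realType) (V : normedModType R[i]) (t : R) (x : V) :
  rnorm (t%:C%C *: x) = `|t| * rnorm x.
Proof. by rewrite rnormZ /= expr0n addr0 sqrtr_sqr. Qed.

(** * The Riesz representation theorem *)

Lemma gt0_complex (R : realType) (e : R[i]) :
  0 < e -> exists2 r : R, 0 < r & e = r%:C%C.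
Proof. by case: e => a b; rewrite ltcE /= => /andP[/eqP -> a0]; exists a. Qed.

Section Riesz.
Context (R : realType) (V : hilbertType R) (phi : V -> R[i]) (M : R).
Hypothesis phi_lin : linear_for *%R phi.
Hypothesis phi_bnd : forall x, complex.Re (phi x) <= M * rnorm x.

(* Dirichlet principle: a minimiser [u] of [J] satisfies [phi = inner ^~ u].
   [2 * D x] is the real derivative of [J] at [x], so that only [D] has to be
   shown to vanish at [u]. *)
Let J x : R := rnorm x ^+ 2 - 2 * complex.Re (phi x).
Let D x h : R := complex.Re (inner x h) - complex.Re (phi h).

Let phiD x y : phi (x + y) = phi x + phi y.
Proof. by have := phi_lin 1 x y; rewrite !scale1r mul1r. Qed.

Let phi0 : phi 0 = 0.
Proof. by apply: (addrI (phi 0)); rewrite -phiD !addr0. Qed.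

Let phiZ k x : phi (k *: x) = k * phi x.
Proof. by have := phi_lin k x 0; rewrite phi0 !addr0. Qed.

Let DZ x (t : R) h : D x (t%:C%C *: h) = t * D x h.
Proof.
rewrite /D phiZ linearZr_LR /= !cReM /= ?oppr0 !mul0r !subr0.
by rewrite mulrBr.
Qed.

Let JD x h : J (x + h) = J x + 2 * D x h + rnorm h ^+ 2.
Proof.
by rewrite /J /D phiD cReD !rnorm_sqE dot_sqnD; lra.
Qed.

Let J_ge x : - M ^+ 2 <= J x.
Proof.
rewrite /J; have := phi_bnd x; have := sqr_ge0 (rnorm x - M); lra.
Qed.

Let m := inf (range J).

Let hasinfJ : has_inf (range J).
Proof.
split; first by exists (J 0), 0.
by exists (- M ^+ 2) => _ [x _ <-]; exact: J_ge.
Qed.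

Let m_le x : m <= J x.
Proof. by apply: ge_inf; [exact: hasinfJ.2|exists x]. Qed.

Let sublevel (e : R) : set V := [set x | J x < m + e].

Let sublevel_neq0 e : 0 < e -> sublevel e !=set0.
Proof.
by move=> e0; have [_ [x _ <-] xe] := inf_adherent e0 hasinfJ; exists x.
Qed.

Let half_add (x : V) : (2^-1)%:C%C *: x + (2^-1)%:C%C *: x = x.
Proof.
rewrite -scalerDl -rmorphD -[2^-1]mul1r -splitr /=.
by rewrite scale1r.
Qed.

(** The parallelogram law: the midpoint of [x] and [y] still has [J >= m], so
    points where [J] is almost minimal are close to each other. *)
Let sublevel_dist e x y :
  sublevel e x -> sublevel e y -> rnorm (x - y) ^+ 2 <= 4 * e.
Proof.
rewrite /sublevel /= => xe ye.
set z := (2^-1)%:C%C *: (x + y); set h := (2^-1)%:C%C *: (x - y).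
have xE : x = z + h.
  rewrite /z /h -scalerDr addrACA subrr addr0 scalerDr; exact/esym/half_add.
have yE : y = z + (-1)%:C%C *: h.
  rewrite rmorphN rmorph1 scaleN1r /z /h -scalerBr opprB.
  rewrite (addrC x) addrACA subrr addr0 scalerDr; exact/esym/half_add.
have hE : rnorm h = 2^-1 * rnorm (x - y) by rewrite /h rnormZr ger0_norm.
have := JD z h; have := JD z ((-1)%:C%C *: h).
rewrite -xE -yE DZ rnormZr normrN1 mul1r hE.
have := m_le z; lra.
Qed.

(** [J (x + t h) >= m] for every real [t]; the bound on the derivative is
    obtained at the minimum over [t] of this quadratic polynomial. *)
Let sublevel_small e x h :
  0 < e -> sublevel (e ^+ 2) x -> `|D x h| <= e * rnorm h.
Proof.
rewrite /sublevel /= => e0 xe.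
have [h0|h0] := eqVneq (rnorm h) 0.
  rewrite h0 mulr0 (rnorm_eq0 h0).
  by have := DZ x 0 0; rewrite scaler0 mul0r => ->; rewrite normr0.
have hp : 0 < rnorm h by rewrite lt_neqAle eq_sym h0 rnorm_ge0.
set n := rnorm h in h0 hp *.
(* the [t] that minimises [J (x + t h)] *)
pose t := - (D x h / n ^+ 2).
have := JD x (t%:C%C *: h); have := m_le (x + t%:C%C *: h).
rewrite DZ rnormZr exprMn real_normK ?num_real// -/n /t => le1 eq1.
have : (D x h / n) ^+ 2 <= e ^+ 2.
  have : 2 * (- (D x h / n ^+ 2) * D x h) + (- (D x h / n ^+ 2)) ^+ 2 * n ^+ 2
    = - (D x h / n) ^+ 2 by field.
  lra.
have -> : `|D x h| = `|D x h / n| * n.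
  by rewrite normf_div (ger0_norm (ltW hp)) divfK.
rewrite ler_pM2r//.
by rewrite -(real_normK (num_real (D x h / n))) ler_pXn2r ?nnegrE ?(ltW e0).
Qed.

Let F : set_system V :=
  filter_from [set e : R | 0 < e] (fun e => sublevel (e ^+ 2)).

Let F_proper : ProperFilter F.
Proof.
apply: filter_from_proper; last first.
  by move=> e e0; apply: sublevel_neq0; rewrite exprn_gt0.
apply: filter_from_filter; first by exists 1 => /=.
move=> e1 e2 /= e10 e20; exists (Num.min e1 e2); first by rewrite /= lt_min e10.
have le e e' : 0 < e -> e <= e' -> sublevel (e ^+ 2) `<=` sublevel (e' ^+ 2).
  move=> e0 ee x /lt_le_trans; apply; rewrite lerD2l.
  by rewrite ler_pXn2r ?nnegrE ?(ltW e0) ?(le_trans (ltW e0)).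
by move=> x x_low; split; apply: le x_low;
  rewrite ?lt_min ?e10 ?ge_min ?lexx ?orbT.
Qed.

Let F_ball (u : V) (r : R) : F (ball u r%:C%C) ->
  forall e, 0 < e -> exists2 x, rnorm (u - x) < r & sublevel (e ^+ 2) x.
Proof.
move=> Fu e e0; have FF := F_proper.
have Fe : F (sublevel (e ^+ 2)) by exists e.
have [x [/= ux x_low]] := filter_ex (filterI Fu Fe).
by exists x => //; apply/rnorm_ball.
Qed.

Let F_cvg : exists u : V, forall e : R, 0 < e -> F (ball u e%:C%C).
Proof.
have FF := F_proper.
have : cvg F.
  apply: cauchy_cvg; apply: cauchy_exP => _ /gt0_complex[r r0 ->].
  have r3 : 0 < r / 3 by lra.
  have [x x_low] : sublevel ((r / 3) ^+ 2) !=set0.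
    by apply: sublevel_neq0; rewrite exprn_gt0.
  exists x, (r / 3) => //= y y_low; apply/rnorm_ball.
  have := sublevel_dist x_low y_low => h.
  rewrite -(@ltr_pXn2r _ 2) ?nnegrE ?rnorm_ge0 ?(ltW r0)//.
  by apply: le_lt_trans h _; nra.
move=> /cvg_ex[u Fu]; exists u => e e0.
by apply: Fu; apply: nbhsx_ballx; rewrite ltcR.
Qed.

(** By completeness the sublevel sets of [J] shrink to a point [u], whose
    derivative [D u] vanishes as a limit of arbitrarily small ones. This gives
    the real part of the identity for all [x]; the imaginary part is the real
    part at ['i x]. *)
Lemma riesz_representation : exists u : V, forall x, phi x = inner x u.
Proof.
have [u Fu] := F_cvg; exists u.
have Du h (e : R) : 0 < e -> `|D u h| <= 2 * e * rnorm h.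
  move=> e0; have [x ux x_low] := F_ball (Fu e e0) e0.
  have := sublevel_small h e0 x_low.
  have -> : D u h = D x h + complex.Re (inner (u - x) h).
    by rewrite /D -{1}(subrK x u) linearDl cReD; lra.
  have := Re_inner_le (u - x) h; have := Re_inner_le (- (u - x)) h.
  rewrite linearNl raddfN rnormN => h1 h2.
  have := rnorm_ge0 h => h3.
  have : rnorm (u - x) * rnorm h <= e * rnorm h by rewrite ler_wpM2r// ltW.
  rewrite !ler_norml; move: h1 h2; move: (rnorm (u - x) * rnorm h) => p.
  by move=> *; lra.
have D0 h : complex.Re (phi h) = complex.Re (inner h u).
  rewrite Re_innerC; apply/eqP; rewrite eq_sym -subr_eq0 -/(D u h) -normr_eq0.
  apply: contraT => Dh.
  have Dp : 0 < `|D u h| by rewrite lt_neqAle eq_sym Dh normr_ge0.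
  have hp : 0 < rnorm h by have := Du h 1 ltr01; lra.
  have := Du h (`|D u h| / (4 * rnorm h)).
  rewrite divr_gt0 ?mulr_gt0// => /(_ isT).
  have -> : 2 * (`|D u h| / (4 * rnorm h)) * rnorm h = `|D u h| / 2.
    by field; rewrite gt_eqF.
  by move=> ?; exfalso; lra.
move=> h; apply: complex_eq; first exact: D0.
have := D0 ('i%C *: h); rewrite phiZ linearZl_LR /= !cReM /= !mul0r !mul1r.
by rewrite !sub0r => /oppr_inj.
Qed.

End Riesz.

(** * Adjoints *)

Lemma continuous_linear_rnormP (R : realType) (V W : normedModType R[i])
    (f : {linear V -> W}) :
  continuous f <->
  exists2 M : R, 0 <= M & forall x, rnorm (f x) <= M * rnorm x.
Proof.
rewrite -linear_bounded_continuous linear_boundedP; split.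
  move=> /pinfty_ex_gt0[_ /gt0_complex[M M0 ->] fM]; exists M => [|x].
    exact: ltW.
  by have := fM x; rewrite !rnormE -rmorphM lecR.
move=> [M M0 fM]; near=> r => x; rewrite !rnormE.
have /ltW rM : M%:C%C < r.
  by near: r; apply: nbhs_pinfty_gt; rewrite ger0_real// ler0c.
apply: (@le_trans _ _ (M%:C%C * (rnorm x)%:C%C)).
  by rewrite -rmorphM lecR.
by rewrite ler_wpM2r// ler0c rnorm_ge0.
Unshelve. all: by end_near. Qed.

(** Riesz's theorem applied to [x |-> inner (f x) y]. The adjoint obeys the same
    bound [M]: apply the Cauchy-Schwarz inequality to
    [rnorm (g y) ^+ 2 = inner (f (g y)) y]. *)
Lemma adjoint_exists (R : realType) (V : hilbertType R) (W : preHilbertType R)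
    (f : {linear V -> W}) (M : R) :
  0 <= M -> (forall x, rnorm (f x) <= M * rnorm x) ->
  exists2 g : {linear W -> V}, forall x y, inner (f x) y = inner x (g y) &
    forall y, rnorm (g y) <= M * rnorm y.
Proof.
move=> M0 fM.
have /choice[g gE] : forall y, exists u, forall x, inner (f x) y = inner x u.
  move=> y; apply: (@riesz_representation _ _ _ (M * rnorm y)).
    by move=> k x x'; rewrite linearP linearDl linearZl_LR.
  move=> x; apply: le_trans (Re_inner_le _ _) _.
  by rewrite mulrAC ler_wpM2r ?rnorm_ge0.
have g_linear : linear g.
  move=> k y z; apply: inner_eqP => x.
  by rewrite -gE !linearDr !linearZr_LR /= !gE.
pose G : {linear W -> V} :=
  HB.pack g (GRing.isLinear.Build _ _ _ _ g g_linear).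
exists G => [//|y].
have [y0|y0] := eqVneq (rnorm (g y)) 0.
  by rewrite y0 mulr_ge0 ?rnorm_ge0.
have yp : 0 < rnorm (g y) by rewrite lt_neqAle eq_sym y0 rnorm_ge0.
rewrite -(ler_pM2r yp) -expr2 rnorm_sqE /dot_sqn -gE.
apply: le_trans (Re_inner_le _ _) _.
by rewrite mulrAC ler_wpM2r ?rnorm_ge0.
Qed.

Lemma inner_adjoint (R : realType) (V : hilbertType R) (f : {linear V -> V}) :
  continuous f -> forall x y, inner (f x) y = inner x (adjoint f y).
Proof.
move=> /continuous_linear_rnormP[M M0 fM].
have [g gE _] := adjoint_exists M0 fM.
exact: (@getPex _ [set g : V -> V | forall x y, inner (f x) y = inner x (g y)]
  (ex_intro _ (g : V -> V) gE)).
Qed.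

Section InverseAdjoint.
Context (R : realType) (H : hilbertType R).

(** The inverse of the adjoint is the adjoint of the inverse; this identity
    determines [inv_adjoint T] and is the only property of it used below. *)
Lemma inner_inv_adjoint (T : invop H) x y :
  inner (iopV T x) y = inner x (inv_adjoint T y).
Proof.
have [M M0 TM] := (continuous_linear_rnormP _).1 (@iopV_continuous _ _ T).
have [g gE _] := adjoint_exists M0 TM.
have TE := inner_adjoint (@iop_continuous _ _ T).
have adjK : adjoint T (inv_adjoint T y) = y.
  apply: pinvK; rewrite inE; exists (g y) => //; apply: inner_eqP => h.
  by rewrite -TE -gE iopK.
by rewrite -{1}adjK -TE iopVK.
Qed.

Lemma inv_adjoint_linear (T : invop H) : linear (inv_adjoint T).
Proof.
move=> k y z; apply: inner_eqP => x.
by rewrite -inner_inv_adjoint !linearDr !linearZr_LR /= !inner_inv_adjoint.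
Qed.

HB.instance Definition _ (T : invop H) := GRing.isLinear.Build R[i] H H *:%R
  (inv_adjoint T) (inv_adjoint_linear T).

End InverseAdjoint.

(** * Monomials *)

Lemma rsum_single (R : realType) (I : choiceType) (f : I -> R) (a : I) :
  (forall b, b != a -> f b = 0) -> rsum f = f a.
Proof.
move=> f0.
have es (g : I -> \bar R) : (forall b, 0 <= g b)%E ->
    (forall b, b != a -> g b = 0%E) -> \esum_(i in [set: I]) g i = g a.
  move=> gp g0; rewrite -[RHS]esum_set1// [RHS]esum_mkcond.
  apply: eq_esum => b _; case: ifPn => //; rewrite notin_setE /= => /eqP.
  by move/g0.
have fp b : (0 <= (EFin \o f)^\+ b)%E by exact: funepos_ge0.
have fn b : (0 <= (EFin \o f)^\- b)%E by exact: funeneg_ge0.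
rewrite /rsum (es _ fp) ?(es _ fn) => [|b ba|b ba]; last 2 first.
- by rewrite funenegE /= f0// oppr0 maxxx.
- by rewrite funeposE /= f0// maxxx.
rewrite funeposE funenegE /= -!EFin_max /= !maxEle; do 2!case: ifP; lra.
Qed.

Lemma csum_single (R : realType) (I : choiceType) (c : I -> R[i]) (a : I) :
  (forall b, b != a -> c b = 0) -> csum c = c a.
Proof.
move=> c0; apply: complex_eq; rewrite /csum /=; apply: rsum_single => b ba.
all: by rewrite c0.
Qed.

Section Monomials.
Context (R : realType) (H : hilbertType R) (d : nat) (B : mindex d -> invop H).

Lemma monomial_subproof (a : mindex d) (h : H) :
  (fun b => if b == a then h else 0) \in hsq_pred B.
Proof.
rewrite inE /= (_ : esum _ _ = (rnorm (B a h) ^+ 2)%:E) ?ltry//.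
rewrite -[RHS](@esum_set1 _ _ _ (fun b => (rnorm (B b h) ^+ 2)%:E)); last first.
  by rewrite lee_fin sqr_ge0.
rewrite [RHS]esum_mkcond; apply: eq_esum => b _.
case: eqVneq => [->|ba]; first by rewrite mem_set.
rewrite memNset ?linear0 /rnorm ?normr0 ?expr0n//= => /eqP.
by rewrite (negPf ba).
Qed.

Definition monomial a h : hsq B := Hsq (monomial_subproof a h).

Lemma inner_monomial a h (x : hsq B) :
  inner (monomial a h) x = inner (B a h) (B a (x a)).
Proof.
rewrite -[LHS]/(hsq_inner _ _) /hsq_inner (@csum_single _ _ _ a) /= ?eqxx//.
by move=> b /negPf ->; rewrite linear0 linear0l.
Qed.

(** Polynomials are finite sums of monomials, so that a linear map is a point
    evaluation as soon as it is one on monomials. *)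
Lemma polynomialE (x : hsq B) : is_polynomial x ->
  x = \sum_(a <- fset_set [set a | x a != 0]) monomial a (x a).
Proof.
move=> xp; apply: val_inj; apply/funext => b /=.
have coef_sum r : hsq_coef (\sum_(a <- r) monomial a (x a)) b =
    \sum_(a <- r) (if b == a then x a else 0).
  by elim: r => [|a r IH]; rewrite ?big_nil// !big_cons hsq_coefD IH.
rewrite coef_sum; have [xb|xb] := eqVneq (x b) 0.
  by rewrite big1// => a _; case: eqP => // <-.
rewrite (big_fsetD1 b) /=; last by rewrite in_fset_set// inE.
rewrite eqxx big_seq big1 ?addr0// => a; rewrite !inE => /andP[ab _].
by rewrite eq_sym (negPf ab).
Qed.

Lemma monomial_polynomial a h : is_polynomial (monomial a h).
Proof.
apply: (sub_finite_set _ (finite_set1 a)) => b /=.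
by case: (b =P a) => // _; rewrite eqxx.
Qed.

Lemma peval_monomial w a h : peval w (monomial a h) = mpow w a *: h.
Proof.
rewrite /peval (fsbigTE [fset a]%fset); last first.
  by move=> b; rewrite inE /= => /negPf ->; rewrite scaler0.
by rewrite big_seq_fset1 /= eqxx.
Qed.

Lemma peval_polynomial w (x : hsq B) : is_polynomial x ->
  peval w x = \sum_(a <- fset_set [set a | x a != 0]) mpow w a *: x a.
Proof.
move=> xp; rewrite /peval (fsbigTE (fset_set [set a | x a != 0])) //.
move=> a; rewrite in_fset_set// notin_setE /= => /negP; rewrite negbK.
by move=> /eqP ->; rewrite scaler0.
Qed.

End Monomials.

(** * The recursion of the moments *)

Lemma big_invop_foldr (R : realType) (H : normedModType R[i]) (I : Type)
    (r : seq I) (F : I -> invop H) (x : H) :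
  (\big[@invop_comp R H/@invop_id R H]_(i <- r) F i) x =
  foldr (fun i => F i) x r.
Proof. by elim: r => [|i r IH]; rewrite ?big_nil// big_cons /= IH. Qed.

(** When the factors before [i] are trivial, enlarging the factor [i] by [G] on
    the left amounts to composing the whole product with [G] on the left. *)
Lemma foldr_insert (T : Type) (d : nat) (F F' : 'I_d -> T -> T) (G : T -> T)
    (i : 'I_d) (r : seq 'I_d) (x : T) :
  (forall (l : 'I_d) y, (l < i)%N -> F l y = y) ->
  (forall (l : 'I_d) y, l != i -> F' l y = F l y) ->
  (forall y, F' i y = G (F i y)) ->
  pairwise (fun a b : 'I_d => (a < b)%N) r ->
  foldr F' x r = if i \in r then G (foldr F x r) else foldr F x r.
Proof.
move=> F1 FF' FG; elim: r => //= l r IH /andP[lr /IH{}IH].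
rewrite inE; have [il|il] := eqVneq i l.
  rewrite -il FG IH; case: ifPn => //= ir.
  by move/allP: lr => /(_ _ ir); rewrite -il ltnn.
rewrite FF' 1?eq_sym// IH /=; case: ifPn => //= ir.
by rewrite !F1//; move/allP: lr; exact.
Qed.

Section Moments.
Context (R : realType) (H : hilbertType R) (d : nat).
Context (A : 'I_d -> mindex d -> invop H).
Implicit Types (a g : mindex d) (i j l : 'I_d).

Lemma mi_addE a j i : (a + mi_eps j) i = (a i + (i == j))%N.
Proof. by rewrite !ffunE. Qed.

(** The index at which the [l]-th block of a moment starts: the coordinates
    before [l] have already been brought down to zero. *)
Lemma mi_sub_lead a l :
  mi_sub a (\sum_(m < d | (m < l)%N) mi_eps m *+ a m) =
  [ffun p : 'I_d => if (p < l)%N then 0%N else a p].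
Proof.
apply/ffunP => p; rewrite !ffunE sum_ffunE.
have E m : (mi_eps m *+ a m) p = if m == p then a p else 0%N.
  rewrite ffunMnE ffunE eq_sym; case: eqP => [->|_]; last exact: mul0rn.
  by rewrite -[LHS]/((a p)%:R) natn.
under eq_bigr do rewrite E.
case: ifPn => pl.
  rewrite (bigD1 p)//= eqxx big1 ?addr0 ?subnn// => m /andP[_ /negPf ->//].
rewrite big1 ?subn0// => m ml; case: eqP => // mp.
by rewrite -mp ml in pl.
Qed.

Lemma weight_prodS i g k x :
  weight_prod A i (g + mi_eps i) k.+1 x = A i g (weight_prod A i g k x).
Proof.
rewrite /weight_prod !big_invop_foldr /index_iota !subSS !subn0 /=.
rewrite mulr1n mi_subK; congr (A i g _).
rewrite -[2%N]addn1 iotaDl foldr_map.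
elim: (iota _ _) => //= n s ->; congr (A i _ _).
apply/ffunP => p; rewrite ffunE [RHS]ffunE add1n mulrS.
rewrite [(g + _) p]ffunE [(mi_eps i + _) p]ffunE.
by rewrite addrC; exact: subnDl.
Qed.

(** If the coordinates of [g] before [i] vanish, then the blocks of the moment at
    [g] before the [i]-th are trivial and [A i g] is the leading factor of the
    moment at [g + mi_eps i]. *)
Lemma moment_lead g i x : (forall l, (l < i)%N -> g l = 0%N) ->
  moment A (g + mi_eps i) x = A i g (moment A g x).
Proof.
move=> g0; rewrite /moment !big_invop_foldr.
rewrite (@foldr_insert _ _ (fun j => weight_prod A j (mi_sub g
    (\sum_(l < d | (l < j)%N) mi_eps l *+ g l)) (g j)) _ (A i g) i).
- by rewrite mem_index_enum.
- move=> l y li; rewrite g0//.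
  by rewrite /weight_prod big_invop_foldr.
- move=> l y li; rewrite !mi_sub_lead mi_addE (negPf li) addn0.
  have [lti|] := ltnP l i; first by rewrite g0// /weight_prod !big_invop_foldr.
  move=> il; congr (weight_prod A l _ _ y); apply/ffunP => p; rewrite !ffunE.
  case: ifPn => //; rewrite -leqNgt => lp.
  case: eqP => [pi|]; last by rewrite addr0.
  by move: li; rewrite -val_eqE eqn_leq il -pi lp.
- move=> y; rewrite !mi_sub_lead mi_addE eqxx addn1.
  have e1 : [ffun p : 'I_d => if (p < i)%N then 0%N else (g + mi_eps i) p] =
      g + mi_eps i.
    apply/ffunP => p; rewrite !ffunE; case: ifPn => // pi.
    by rewrite g0//; case: eqP => // pi'; rewrite pi' ltnn in pi.
  have e2 : [ffun p : 'I_d => if (p < i)%N then 0%N else g p] = g.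
    by apply/ffunP => p; rewrite !ffunE; case: ifPn => // /g0.
  by rewrite e1 e2 weight_prodS.
- rewrite -(@pairwise_map _ _ val (fun m n : nat => (m < n)%N)).
  rewrite -sorted_pairwise; last exact: ltn_trans.
  rewrite (_ : map _ _ = iota 0 d) ?iota_ltn_sorted//.
  by rewrite [index_enum _]unlock -enumT val_enum_ord.
Qed.

(** The moment of [a] composes weights along one distinguished path from [0] to
    [a]; commutation makes the choice of path irrelevant. When the last step
    [j] is not the distinguished one, it is exchanged with the step along the
    least coordinate [i] of [a] that is non-zero, and the induction is on the
    total degree of [a]. *)
Lemma momentS (A_commuting : commuting_weights A) a j x :
  moment A (a + mi_eps j) x = A j a (moment A a x).
Proof.
have [n] := ubnP (\sum_i a i)%N; elim: n a => // n IH a an.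
have [a0|/existsNP[l /not_implyP[lj /eqP al]]] :=
    pselect (forall l : 'I_d, (l < j)%N -> a l = 0%N); first exact: moment_lead.
have [i ai imin] := @arg_minnP _ l (fun l => a l != 0%N) val al.
have ij : (i < j)%N by exact: leq_ltn_trans (imin l al) lj.
set g := mi_sub a (mi_eps i).
have ga : g + mi_eps i = a by exact: mi_addK.
have gi (l' : 'I_d) : (l' < i)%N -> g l' = 0%N.
  move=> li; rewrite /g !ffunE; apply/eqP; apply: contraTT li => h.
  rewrite -leqNgt; apply: imin; apply: contraNneq h => ->.
  by rewrite sub0n.
have gn : (\sum_i g i < n)%N.
  rewrite -ltnS; apply: leq_ltn_trans an; rewrite -ga.
  under [X in (_ < X)%N]eq_bigr do rewrite mi_addE.
  rewrite big_split /= -[X in (X < _)%N]addn0 ltn_add2l (bigD1 i)//= eqxx.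
  by [].
rewrite -{1}ga addrAC moment_lead; last first.
  move=> l' li; rewrite mi_addE gi//; case: eqP => // l'j.
  by move: ij; rewrite ltnNge -l'j ltnW.
by rewrite IH// A_commuting -moment_lead// ga.
Qed.

End Moments.

(** * Bounded point evaluations *)

Section Evaluations.
Context (R : realType) (H : hilbertType R) (d : nat) (B : mindex d -> invop H).
Implicit Types (w : 'I_d -> R[i]) (a : mindex d) (y : H).

Lemma rnorm_conjZ (V : normedModType R[i]) (c : R[i]) (x : V) :
  rnorm (c^*%R *: x) = rnorm (c *: x).
Proof. by rewrite !rnormZ norm_conjC. Qed.

(** The supremum over the unit sphere, made homogeneous in [y]. *)
Lemma Omega_bounded w : Omega B w -> exists2 C : R, 0 <= C & forall y,
  (\esum_(a in [set: mindex d])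
    (rnorm (mpow w a *: inv_adjoint (B a) y) ^+ 2)%:E <=
   (C ^+ 2 * rnorm y ^+ 2)%:E)%E.
Proof.
pose S y := (\esum_(a in [set: mindex d])
    (rnorm (mpow w a *: inv_adjoint (B a) y) ^+ 2)%:E)%E.
have SZ (t : R) y : S (t%:C%C *: y) = ((t ^+ 2)%:E * S y)%E.
  rewrite /S -esumZ ?sqr_ge0//; last by move=> a; rewrite sqr_ge0.
  apply: eq_esum => a _; congr EFin.
  rewrite linearZ /= scalerA mulrC -scalerA rnormZr exprMn.
  by rewrite real_normK ?num_real.
rewrite /Omega /=; set s := ereal_sup _ => sfin.
have [C C0 SC] : exists2 C : R, 0 <= C &
    forall y, rnorm y = 1 -> (S y <= C%:E)%E.
  exists (fine (maxe s 0)).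
    by rewrite fine_ge0// le_max lexx orbT.
  move=> y y1; rewrite fineK; last first.
    by rewrite ge0_fin_numE ?le_max ?lexx ?orbT// gt_max sfin ltry.
  rewrite le_max; apply/orP; left; apply: ereal_sup_ubound; exists y => //.
  by apply: eq_esum => a _; rewrite rnormZ exprMn.
exists (Num.sqrt C) => [|y]; rewrite ?sqrtr_ge0// sqr_sqrtr//.
have [->|y0] := eqVneq y 0.
  have -> : (0 : H) = 0%:C%C *: 0 by rewrite scaler0.
  rewrite -/(S _) SZ expr0n mul0e lee_fin mulr_ge0// sqr_ge0//.
have n0 : 0 < rnorm y.
  rewrite lt_neqAle rnorm_ge0 andbT eq_sym.
  by apply: contraNneq y0 => /rnorm_eq0 ->.
have yE : y = (rnorm y)%:C%C *: ((rnorm y)^-1%:C%C *: y).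
  by rewrite scalerA -rmorphM mulfV ?gt_eqF// rmorph1 scale1r.
rewrite -/(S y) {1}yE SZ muleC [leRHS]EFinM lee_wpmul2r ?lee_fin ?sqr_ge0//.
by apply: SC; rewrite rnormZr ger0_norm ?invr_ge0 ?ltW// mulVf ?gt_eqF.
Qed.

(** The adjoint [g] of the evaluation at [w] sends [y] to the power series with
    [B a (g y a) = (mpow w a)^* *: inv_adjoint (B a) y], as seen by testing
    against monomials. Hence the sum that defines [Omega] is the squared norm
    of [g y], which the boundedness of [g] controls. *)
Lemma point_evaluation_Omega w : bounded_point_evaluations B w -> Omega B w.
Proof.
move=> [E [/continuous_linear_rnormP[M M0 EM] Ew]].
have [g gE gM] := adjoint_exists M0 EM.
have coefE y a : B a (g y a) = (mpow w a)^*%R *: inv_adjoint (B a) y.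
  apply: inner_eqP => h; rewrite -{1}[h](iopVK (B a)) -inner_monomial -gE.
  rewrite Ew; last exact: monomial_polynomial.
  by rewrite peval_monomial linearZl_LR linearZr_LR /= inner_inv_adjoint conjCK.
apply: (@le_lt_trans _ _ (M ^+ 2)%:E); last exact: ltry.
apply: ge_ereal_sup => _ [y y1 <-].
rewrite (_ : esum _ _ = (rnorm (g y) ^+ 2)%:E).
  rewrite lee_fin ler_pXn2r ?nnegrE ?rnorm_ge0//.
  by rewrite (le_trans (gM y))// y1 mulr1.
rewrite hsq_rnorm; apply: eq_esum => a _.
by rewrite coefE rnorm_conjZ rnormZ exprMn.
Qed.

(** Conversely the power series [k y], the reproducing kernel at [w] applied to
    [y], lies in the space and depends boundedly on [y]. The adjoint of
    [y |-> k y] is then the required extension of the evaluation. *)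
Lemma Omega_point_evaluation w : Omega B w -> bounded_point_evaluations B w.
Proof.
move=> /Omega_bounded[C C0 SC].
pose k y a : H := (mpow w a)^*%R *: iopV (B a) (inv_adjoint (B a) y).
have Bk y a : B a (k y a) = (mpow w a)^*%R *: inv_adjoint (B a) y.
  by rewrite /k linearZ /= iopVK.
have kP y : k y \in hsq_pred B.
  rewrite inE /=; under eq_esum do rewrite Bk rnorm_conjZ.
  exact: le_lt_trans (SC y) (ltry _).
have k_linear : linear (fun y => Hsq (kP y)).
  move=> c y z; apply: val_inj; apply/funext => a /=.
  rewrite -[RHS]/(c *: k y a + k z a) /k.
  by rewrite !linearP.
pose K : {linear H -> hsq B} := HB.pack (fun y => Hsq (kP y))
  (GRing.isLinear.Build _ _ _ _ _ k_linear).
have KC y : rnorm (K y) <= C * rnorm y.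
  rewrite -(@ler_pXn2r _ 2) ?nnegrE ?rnorm_ge0 ?mulr_ge0 ?rnorm_ge0//.
  rewrite exprMn -lee_fin hsq_rnorm; apply: le_trans (SC y).
  by apply: le_esum => a _; rewrite -[K y a]/(k y a) Bk rnorm_conjZ.
have [E KE EC] := adjoint_exists C0 KC.
exists E; split; first by apply/continuous_linear_rnormP; exists C.
have E_monomial a h : E (monomial B a h) = mpow w a *: h.
  apply: inner_eqP => y; rewrite -KE dotC inner_monomial -[K y a]/(k y a) Bk.
  rewrite linearZr_LR /= conjCK -inner_inv_adjoint iopK.
  by rewrite rmorphM /= -dotC linearZr_LR.
move=> x xp; rewrite peval_polynomial// {1}(polynomialE xp) linear_sum.
by apply: eq_bigr => a _; rewrite E_monomial.
Qed.

End Evaluations.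

(** * Joint eigenvectors *)

Section Eigenvectors.
Context (R : realType) (H : hilbertType R) (d : nat).
Context (A : 'I_d -> mindex d -> invop H).
Context (A_bounded : bounded_weights A).

Lemma multishift_linear j : linear (multishift A_bounded j).
Proof.
move=> k x y; apply: val_inj; apply/funext => a /=.
rewrite -[RHS]/(k *: multishift_fun A j x a + multishift_fun A j y a).
rewrite /multishift_fun; case: ifP => _; first by rewrite scaler0 addr0.
exact: linearP.
Qed.

HB.instance Definition _ j := GRing.isLinear.Build _ _ _ _
  (multishift A_bounded j) (multishift_linear j).

(** Up to vanishing terms, the squared norm of [T j x] is the sum over [a] of
    the squared norms of the entries [A j a (x a)] at [a + mi_eps j]. *)
Lemma multishift_continuous j : continuous (multishift A_bounded j).
Proof.
have [M M0 AM] := rnorm_opnorm j A_bounded.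
apply/continuous_linear_rnormP; exists M => // x.
rewrite -(@ler_pXn2r _ 2) ?nnegrE ?rnorm_ge0 ?mulr_ge0 ?rnorm_ge0//.
rewrite exprMn -lee_fin hsq_rnorm EFinM hsq_rnorm.
rewrite -esumZ ?sqr_ge0//; last by move=> a; rewrite sqr_ge0.
pose Q := [set a : mindex d | a j != 0%N].
rewrite (_ : esum _ _ =
    \esum_(a in Q) (rnorm (multishift_fun A j x a) ^+ 2)%:E)%E;
  last first.
  rewrite [RHS]esum_mkcond; apply: eq_esum => a _.
  case: ifPn => //; rewrite notin_setE /Q /= => /negP; rewrite negbK => a0.
  by rewrite /multishift_fun a0 /rnorm normr0 expr0n.
rewrite (@reindex_esum _ _ _ [set: mindex d] _ (fun a => a + mi_eps j)).
  apply: le_esum => a _; rewrite lee_fin /multishift_fun mi_subK mi_addE eqxx.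
  rewrite addn1 /= -exprMn ler_pXn2r ?nnegrE ?rnorm_ge0//.
  by rewrite mulr_ge0 ?rnorm_ge0.
split.
- by move=> a _; rewrite /Q /= mi_addE eqxx addn1.
- by move=> a b _ _ /(congr1 (fun c => mi_sub c (mi_eps j))); rewrite !mi_subK.
- by move=> a aj; exists (mi_sub a (mi_eps j)); rewrite ?mi_addK.
Qed.

Lemma multishift_monomial j b h :
  multishift A_bounded j (monomial _ b h) = monomial _ (b + mi_eps j) (A j b h).
Proof.
apply: val_inj; apply/funext => a /=; rewrite /multishift_fun /=.
have [->|ab] := eqVneq a (b + mi_eps j).
  by rewrite mi_addE eqxx addn1 /= mi_subK eqxx.
case: ifPn => // aj; case: eqP => [e|]; last by rewrite linear0.
by move/eqP: ab; rewrite -e mi_addK.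
Qed.

(** The recursion of the moments, dualised: the adjoint of [A j a] maps
    [inv_adjoint (moment A (a + mi_eps j)) y] to [inv_adjoint (moment A a) y]. *)
Lemma inner_inv_adjoint_momentS (A_commuting : commuting_weights A) j a x y :
  inner (A j a x) (inv_adjoint (moment A (a + mi_eps j)) y) =
  inner x (inv_adjoint (moment A a) y).
Proof.
rewrite -!inner_inv_adjoint -{1}[x](iopVK (moment A a)) -momentS//.
by rewrite iopK.
Qed.

Lemma mpowS (w : 'I_d -> R[i]) a j : mpow w (a + mi_eps j) = w j * mpow w a.
Proof.
rewrite /mpow (bigD1 j)//= [in RHS](bigD1 j)//= mi_addE eqxx addn1 exprS -mulrA.
congr (_ * (_ * _)); apply: eq_bigr => i /negPf ij.
by rewrite mi_addE ij addn0.
Qed.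

(** The family [mpow w a *: inv_adjoint (moment A a) y] is square-summable, and
    the dualised recursion makes it a joint eigenvector: shifting [a] by
    [mi_eps j] only produces the factor [w j]. It is non-zero because its entry
    at [0] is. *)
Lemma Omega_point_spectrum (A_commuting : commuting_weights A) w :
  (exists x : H, x != 0) -> Omega (moment A) w ->
  joint_point_spectrum (fun j => adjoint (multishift A_bounded j)) w.
Proof.
move=> [y y0] /Omega_bounded[C C0 SC].
pose N a := inv_adjoint (moment A a).
have xP : (fun a => mpow w a *: N a y) \in
    hsq_pred (fun _ : mindex d => @invop_id _ H).
  by rewrite inE /=; exact: le_lt_trans (SC y) (ltry _).
exists (Hsq xP).
  apply: contraNneq y0 => /(congr1 (fun x : l2 H d => x 0)) /=.
  rewrite -[X in _ = X]/(0 : H) /mpow big1 ?scale1r; last first.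
    by move=> j _; rewrite ffunE.
  move=> N0; apply/eqP; apply: inner_eqP => h.
  by rewrite -{1}[h](iopK (moment A 0)) inner_inv_adjoint -/(N 0) N0 !linear0r.
move=> j _ /=; apply/eqP; rewrite subr_eq0; apply/eqP.
apply: val_inj; apply/funext => b.
rewrite -[RHS]/(w j *: (mpow w b *: N b y)).
apply: inner_eqP => h.
rewrite -[LHS](@inner_monomial _ _ _ (fun=> @invop_id _ H)).
rewrite -inner_adjoint; last exact: multishift_continuous.
rewrite /= multishift_monomial inner_monomial /= mpowS.
by rewrite scalerA !linearZr_LR /= inner_inv_adjoint_momentS.
Qed.

End Eigenvectors.

Unset Implicit Arguments.

Theorem proposition5p3 (R : realType) (H : hilbertType R) (d : nat)
    (A : 'I_d -> mindex d -> invop H)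
    (d_ge1 : (1 <= d)%N)
    (H_separable : separable_space H)
    (H_nonzero : exists x : H, x != 0)
    (A_bounded : bounded_weights A)
    (A_commuting : commuting_weights A) :
  let T := multishift A_bounded in
  let B := moment A in
  bounded_point_evaluations B `<=` joint_point_spectrum (fun j => adjoint (T j))
  /\ bounded_point_evaluations B = Omega B.
Proof.
move=> T B.
have BE : bounded_point_evaluations B = Omega B.
  apply/seteqP; split; first exact: point_evaluation_Omega.
  exact: Omega_point_evaluation.
by split=> //; rewrite BE => w; exact: Omega_point_spectrum.
Qed.
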